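(* Let $n$ be an even integer and let $C_n$ be the cycle on $n$ vertices. Then $\widetilde{r}_{ind}(C_n) \le 367n-27$.
   Context: The online Ramsey game for a target graph $H$ is played between Builder and Painter on an infinite set of vertices, initially with no edges. In each round Builder adds a new edge between two vertices (forming the background graph $G$), and Painter immediately colors that edge red or blue. The induced online Ramsey number $\widetilde{r}_{ind}(H)$ is the minimum number $m$ such that Builder has a strategy guaranteeing that, against any Painter strategy, after at most $m$ rounds there is a monochromatic induced copy of $H$ in $G$, i.e. a vertex set $S$ such that the subgraph of $G$ induced on $S$ is isomorphic to $H$ and all its edges have the same color ($\infty$ if no such strategy exists). *)

(* Defs.v *)
From HB Require Import structures.
From mathcomp Require Import all_boot.
From mathcomp Require Import boolp.

Set Implicit Arguments.
Unset Strict Implicit.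
Unset Printing Implicit Defensive.

Record sgraph := SGraph {
  vertex :> Type;
  adj : rel vertex;
  adj_sym : symmetric adj;
  adj_irr : irreflexive adj }.

Definition isomorphic (G H : sgraph) : Prop :=
  exists f : G -> H,
    bijective f /\ forall x y : G, adj (f x) (f y) = adj x y.

Section Induced.
Variables (G : sgraph) (S : pred G).

Definition induced_adj : rel {x : G | S x} :=
  fun x y => adj (sval x) (sval y).

Lemma induced_adj_sym : symmetric induced_adj.
Proof. by move=> x y; exact: adj_sym. Qed.

Lemma induced_adj_irr : irreflexive induced_adj.
Proof. by move=> x; exact: adj_irr. Qed.

Definition induced : sgraph := SGraph induced_adj_sym induced_adj_irr.

End Induced.

Section Cycle.
Variable n : nat.

(* [ordS i] is i + 1 modulo n; this is the cycle C_n when n >= 3. *)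
Definition cycle_adj : rel 'I_n :=
  fun i j => (i != j) && ((j == ordS i) || (i == ordS j)).

Lemma cycle_adj_sym : symmetric cycle_adj.
Proof. by move=> i j; rewrite /cycle_adj eq_sym orbC. Qed.

Lemma cycle_adj_irr : irreflexive cycle_adj.
Proof. by move=> i; rewrite /cycle_adj eqxx. Qed.

Definition cycle_graph : sgraph := SGraph cycle_adj_sym cycle_adj_irr.

End Cycle.

(* The board is [nat]. A position lists the edges in the order in which they
   were built, each with its color: [true] is red and [false] is blue. *)
Definition position : Type := seq ((nat * nat) * bool).

Definition colored (h : position) (c : bool) (u v : nat) : bool :=
  (((u, v), c) \in h) || (((v, u), c) \in h).

Section Background.
Variable h : position.

(* The conjunct [u != v] only matters for lists that contain a loop, which
   no legal play produces. *)
Definition background_adj : rel nat :=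
  fun u v => (u != v) && (colored h true u v || colored h false u v).

Lemma background_adj_sym : symmetric background_adj.
Proof.
by move=> u v; rewrite /background_adj /colored eq_sym; congr (_ && (_ || _));
  rewrite orbC.
Qed.

Lemma background_adj_irr : irreflexive background_adj.
Proof. by move=> u; rewrite /background_adj eqxx. Qed.

Definition background : sgraph :=
  SGraph background_adj_sym background_adj_irr.

End Background.

Definition legal_edge (h : position) (e : nat * nat) : bool :=
  (e.1 != e.2) && ~~ background_adj h e.1 e.2.

Definition builder : Type := position -> nat * nat.

Definition painter : Type := position -> nat * nat -> bool.

Definition legal_builder (B : builder) : Prop :=
  forall h : position, legal_edge h (B h).

Fixpoint play (B : builder) (P : painter) (k : nat) : position :=
  if k is k'.+1 then
    let h := play B P k' in rcons h (B h, P h (B h))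
  else [::].

Definition mono_induced_copy (h : position) (H : sgraph) : Prop :=
  exists S : pred nat,
    isomorphic (@induced (background h) S) H /\
    exists c : bool, forall u v : nat,
      S u -> S v -> background_adj h u v -> colored h c u v.

(* An induced copy may be destroyed by later edges, so it is only required
   to be present after some number k <= m of rounds. *)
Definition builder_wins (H : sgraph) (m : nat) : Prop :=
  exists B : builder, legal_builder B /\
    forall P : painter, exists k : nat,
      k <= m /\ mono_induced_copy (play B P k) H.

(* Natural numbers extended by infinity, which is [None]. *)
Definition enat : Type := option nat.

Definition le_enat (x y : enat) : bool :=
  match x, y with
  | _, None => true
  | None, Some _ => false
  | Some a, Some b => a <= b
  end.

Definition induced_online_ramsey (H : sgraph) : enat :=
  if pselect (exists m : nat, `[< builder_wins H m >]) is left ex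
  then Some (ex_minn ex) else None.

(* Main.v *)
Require Import Defs.
From mathcomp Require Import all_boot boolp zify.

(* A long monochromatic induced path is forced as follows. Builder keeps a red
   and a blue induced path with a common endpoint [u], and grows a third
   monochromatic path from fresh vertices. Whenever the color changes along the
   third path, its end is a vertex [w] with a red and a blue neighbor; the edge
   [u w] adds two vertices to one of the two main paths, at the price of two
   vertices of the other, of which one is regained or given to the first path
   when the endpoint is made common again. This yields a monochromatic, say red,
   induced path with [K] vertices in at most [13 K] rounds.

   Let [N = n - 2]. A chord of the red path between vertices at distance [N + 1]
   must be blue, since otherwise it closes a red induced C_n. If all chords at
   distance [3 N - 1] are blue as well, then a closed zigzag walk with steps
   [N + 1] and [3 N - 1] gives a blue induced C_n. Otherwise there is a red cycle
   of length [3 N]. On it, the vertices fall into triples pairwise at distance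
   [N], so that a new vertex joined to a triple has at most one red edge to it,
   and two new vertices joined to the same triple have a common blue neighbor.
   With three such red cycles, new vertices [y_0, y_1, ...] are joined to
   consecutive triples of a cyclic sequence in which neighbors lie on different
   red cycles, and the common blue neighbors complete a blue C_n. It is induced
   because all chords are odd and hence avoid pairs of vertices of equal parity;
   this, and the even length of the alternating cycle, uses that [n] is even. *)

Set Implicit Arguments.
Unset Strict Implicit.
Unset Printing Implicit Defensive.

(** * Forced positions *)

(** Backward induction replaces strategies: Builder can reach [Q] within [k] further rounds. The
    disjunct [Q h] lets the game stop early, since later edges may destroy an induced copy. *)
Fixpoint force (Q : position -> Prop) (k : nat) (h : position) : Prop :=
  Q h \/ if k is k'.+1 then
    exists2 e, legal_edge h e & forall c, force Q k' (rcons h (e, c))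
  else False.

Lemma force_now Q k h : Q h -> force Q k h.
Proof. by case: k => [|k]; left. Qed.

Lemma force_leq Q k k' h : k <= k' -> force Q k h -> force Q k' h.
Proof.
elim: k k' h => [|k IH] [|k'] h //=; first by move=> _ [] //; left.
move=> lekk' [|[e le He]]; first by left.
by right; exists e => // c; apply: IH.
Qed.

Lemma force_bind (Q Q' : position -> Prop) k k' h :
  (forall h', Q h' -> force Q' k' h') -> force Q k h -> force Q' (k + k') h.
Proof.
move=> QQ'; elim: k h => [|k IH] h /=; first by case=> // /QQ'.
case=> [/QQ'|[e le He]]; first by apply: (@force_leq _ k' (k + k').+1); lia.
by right; exists e => // c; apply: IH.
Qed.

(** Vertices from [vbound h] on are isolated, which makes them a supply of fresh vertices. *)
Definition vbound (h : position) : nat :=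
  (\max_(e <- h) maxn e.1.1 e.1.2).+1.

Lemma colored_lt h c x y : colored h c x y -> (x < vbound h) && (y < vbound h).
Proof.
have le e : e \in h -> maxn e.1.1 e.1.2 <= \max_(e <- h) maxn e.1.1 e.1.2.
  by move=> eh; rewrite (big_rem e) //= leq_maxl.
by case/orP => /le /=; rewrite /vbound; lia.
Qed.

Lemma adj_lt h x y : background_adj h x y -> (x < vbound h) && (y < vbound h).
Proof. by case/andP=> _ /orP[] /colored_lt. Qed.

Lemma adj_ge h x y : vbound h <= x -> background_adj h x y = false.
Proof. by move=> hx; apply/negP => /adj_lt; lia. Qed.

Lemma legal_edge_exists h : exists e, legal_edge h e.
Proof.
exists (vbound h, (vbound h).+1); rewrite /legal_edge /= adj_ge //.
by rewrite neq_ltn leqnn.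
Qed.

Lemma size_play B P k : size (play B P k) = k.
Proof. by elim: k => //= k IH; rewrite size_rcons IH. Qed.

Lemma force_builder_wins H m :
  force (mono_induced_copy^~ H) m [::] -> builder_wins H m.
Proof.
set Q := mono_induced_copy^~ H => F0.
(* A strategy sees only the position, so the number of rounds left is read off from its length. The
   implication makes [ok] satisfiable at every position, so that choice applies. *)
pose ok h e := legal_edge h e /\
  ((exists2 e', legal_edge h e' &
      forall c, force Q (m - (size h).+1) (rcons h (e', c))) ->
   forall c, force Q (m - (size h).+1) (rcons h (e, c))).
have [h|B okB] := @choice _ _ ok.
  have [[e le He]|no] := pselect (exists2 e', legal_edge h e' &
      forall c, force Q (m - (size h).+1) (rcons h (e', c))).
    by exists e; split.
  by have [e le] := legal_edge_exists h; exists e; split.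
exists B; split=> [h|P]; first by case: (okB h).
have main k : k <= m ->
    (exists2 j, j <= k & Q (play B P j)) \/ force Q (m - k) (play B P k).
  elim: k => [_|k IH lekm]; first by right; rewrite subn0.
  case: IH => [|[j lejk Qj]|]; first lia.
    by left; exists j => //; lia.
  have -> : m - k = (m - k.+1).+1 by lia.
  case=> [Qk|]; first by left; exists k => //; lia.
  have := (okB (play B P k)).2; rewrite size_play => okk /okk Hk.
  by right=> /=; apply: Hk.
case: (main m (leqnn m)) => [[j lejm Qj]|]; first by exists j.
by rewrite subnn => -[] // Qm; exists m.
Qed.

Lemma builder_wins_le H m :
  builder_wins H m -> le_enat (induced_online_ramsey H) (Some m).
Proof.
move=> Hm; rewrite /induced_online_ramsey; case: pselect => [ex|no] /=.
  by case: ex_minnP => k _; apply; apply/asboolP.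
by case: no; exists m; apply/asboolP.
Qed.

Lemma colored_sym h c x y : colored h c x y = colored h c y x.
Proof. by rewrite /colored orbC. Qed.

Lemma adj_irrefl h x : background_adj h x x = false.
Proof. exact: background_adj_irr. Qed.

Lemma adjC h x y : background_adj h x y = background_adj h y x.
Proof. exact: background_adj_sym. Qed.

Definition edge_in (T : eqType) (es : seq (T * T)) (x y : T) : bool :=
  ((x, y) \in es) || ((y, x) \in es).

Lemma colored_rcons h e c c' x y :
  colored (rcons h (e, c)) c' x y =
  colored h c' x y || (c' == c) && edge_in [:: e] x y.
Proof.
rewrite /colored /edge_in !mem_rcons !inE !xpair_eqE.
by do ![case: (_ == _) => //=]; do ![case: (_ \in _) => //=].
Qed.

Lemma adj_rcons h e c x y : e.1 != e.2 ->
  background_adj (rcons h (e, c)) x y = background_adj h x y || edge_in [:: e] x y.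
Proof.
case: e => a b /= ab; rewrite /background_adj !colored_rcons.
have ne : edge_in [:: (a, b)] x y -> x != y.
  by rewrite /edge_in !inE !xpair_eqE => /orP[]/andP[/eqP-> /eqP->] //; rewrite eq_sym.
case: (edge_in _ x y) ne => [->//|_]; last by rewrite !andbF !orbF.
by case: c => /=; rewrite !orbT.
Qed.

Lemma adj_colored h x y c : background_adj h x y ->
  colored h c x y \/ colored h (~~ c) x y.
Proof. by case/andP=> _ /orP[]; case: c => /=; auto. Qed.

Lemma colored_adj h x y c : x != y -> colored h c x y -> background_adj h x y.
Proof. by rewrite /background_adj => -> /=; case: c => ->; rewrite ?orbT. Qed.

(** The colors of the new edges are left open, being up to Painter. *)
Definition extends h (es : seq (nat * nat)) h' : Prop :=
  (forall x y, background_adj h' x y = background_adj h x y || edge_in es x y) /\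
  (forall c x y, colored h c x y -> colored h' c x y).

Lemma force_draw Q k es h :
  all (fun e => e.1 != e.2) es ->
  (forall h', extends h es h' -> force Q k h') -> force Q (size es + k) h.
Proof.
elim: es h => [|e es IH] h.
  by move=> _; apply; split=> // x y; rewrite orbF.
case/andP=> ne nes Hk.
(* An edge already on the board is skipped and costs no round, so [es] may contain repetitions and
   old edges. *)
have [ae|nae] := boolP (background_adj h e.1 e.2).
  apply: (@force_leq _ (size es + k)); first by rewrite /=; lia.
  apply: IH => // h' [Ha Hc].
  apply: Hk; split=> // x y; rewrite Ha /edge_in !inE.
  case: e ne ae => a b /= ne ae; rewrite !xpair_eqE.
  have [/andP[/eqP-> /eqP->]|_] := boolP ((x == a) && (y == b)).
    by rewrite ae.
  have [/andP[/eqP-> /eqP->]|_] := boolP ((y == a) && (x == b)).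
    by rewrite adjC ae.
  by [].
rewrite /=; right; exists e; first by rewrite /legal_edge ne.
move=> c; apply: IH => // h' [Ha Hc]; apply: Hk; split=> [x y|c' x y Hxy].
  rewrite Ha adj_rcons // -orbA; congr (_ || _).
  rewrite /edge_in !inE; do ![case: (_ == _) => //=]; by rewrite ?orbT.
by apply: Hc; rewrite colored_rcons Hxy.
Qed.

(** * Long monochromatic induced paths *)

(** Equality is included so that [sep] gives disjointness along with the absence of edges. *)
Definition near h x y := (x == y) || background_adj h x y.

Lemma near_sym h x y : near h x y = near h y x.
Proof. by rewrite /near eq_sym adjC. Qed.

Lemma near_rcons h e c x y : e.1 != e.2 ->
  near (rcons h (e, c)) x y = near h x y || edge_in [:: e] x y.
Proof. by move=> ne; rewrite /near adj_rcons // orbA. Qed.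

Definition sep h (s t : seq nat) : Prop :=
  forall x y, x \in s -> y \in t -> ~~ near h x y.

Lemma sep_sym h s t : sep h s t -> sep h t s.
Proof. by move=> st x y xt ys; rewrite near_sym; apply: st. Qed.

Lemma sep_sub h s t s' t' :
  sep h s t -> {subset s' <= s} -> {subset t' <= t} -> sep h s' t'.
Proof. by move=> st ss tt x y /ss xs /tt; apply: st. Qed.

Lemma sep_cons h x s t : sep h [:: x] t -> sep h s t -> sep h (x :: s) t.
Proof.
move=> xt st a b; rewrite inE => /orP[/eqP->|] bt; last exact: st.
by apply: xt => //; rewrite inE.
Qed.

Lemma sep_cat h s s' t : sep h s t -> sep h s' t -> sep h (s ++ s') t.
Proof. by move=> H H' a b; rewrite mem_cat => /orP[/H|/H'] ?; auto. Qed.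

Lemma sep_notin h s t x : sep h s t -> x \in s -> x \notin t.
Proof. by move=> st xs; apply/negP => /(st _ _ xs); rewrite /near eqxx. Qed.

Lemma sep_rcons h e c s t : e.1 != e.2 ->
  ~~ ((e.1 \in s) && (e.2 \in t)) -> ~~ ((e.2 \in s) && (e.1 \in t)) ->
  sep h s t -> sep (rcons h (e, c)) s t.
Proof.
case: e => a b /= ne H1 H2 st x y xs yt; rewrite near_rcons // negb_or st //=.
rewrite /edge_in !inE !xpair_eqE; apply/negP => /orP[]/andP[/eqP E1 /eqP E2];
  [move: H1 | move: H2]; by rewrite -E1 -E2 xs yt.
Qed.

(** The path is induced in the whole background graph, not merely among the edges of color [c]. *)
Fixpoint ipath h c (s : seq nat) : bool :=
  if s is x :: s' then
    (if s' is y :: s'' then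
       [&& x != y, colored h c x y & all (fun z => ~~ near h x z) s'']
     else true) && ipath h c s'
  else true.

Lemma ipath_behead h c x s : ipath h c (x :: s) -> ipath h c s.
Proof. by case/andP. Qed.

Lemma ipath_sep h c x y s : ipath h c (x :: y :: s) -> sep h [:: x] s.
Proof. by case/andP=> /and3P[_ _ /allP H] _ a b; rewrite inE => /eqP-> /H. Qed.

Lemma ipath_cons h c x y s : x != y -> colored h c x y -> sep h [:: x] s ->
  ipath h c (y :: s) -> ipath h c (x :: y :: s).
Proof.
move=> xy cxy H Hs; apply/andP; split=> //; rewrite xy cxy.
by apply/allP => z zs; apply: H; rewrite ?inE.
Qed.

Lemma ipath_notin h c x s : ipath h c (x :: s) -> x \notin s.
Proof.
case: s => // y s H; rewrite inE negb_or.
by rewrite (sep_notin (ipath_sep H)) ?inE // andbT; case/andP: H => /and3P[].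
Qed.

Lemma ipath_rcons h e c c' s : e.1 != e.2 ->
  ~~ ((e.1 \in s) && (e.2 \in s)) -> ipath h c s ->
  ipath (rcons h (e, c')) c s.
Proof.
move=> ne; elim: s => // x [|y s] IH // H Hs.
have {}IH : ipath (rcons h (e, c')) c (y :: s).
  apply: IH (ipath_behead Hs); apply: contra H => /andP[H1 H2].
  by rewrite inE H1 orbT inE H2 orbT.
case/andP: (Hs) => /and3P[xy cxy _] _.
apply: ipath_cons => //; first by rewrite colored_rcons cxy.
by apply: sep_rcons (ipath_sep Hs) => //; apply: contra H;
  rewrite !inE => /andP[/eqP-> ->]; rewrite eqxx !orbT.
Qed.

Lemma ipath_drop h c s i : ipath h c s -> ipath h c (drop i s).
Proof. by elim: i s => [|i IH] [|x s] //= /andP[_ /IH]. Qed.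

(* The paths of the two colors share the endpoint [u]. Once a path with two
   more vertices [p], [w] has been attached to one of them, the other path
   gives up [u] and its neighbor, and either color of an edge between the two
   new endpoints makes the endpoint common again. *)
Lemma grow_paths Q k h c u R B p w X kx :
  ipath h c [:: p, w, u & R] -> ipath h (~~ c) (u :: B) -> sep h R B ->
  sep h [:: p; w] B -> ipath h kx X -> sep h ([:: p, w, u & R] ++ B) X ->
  (forall h' u' R' B', ipath h' c (u' :: R') -> ipath h' (~~ c) (u' :: B') ->
     sep h' R' B' -> ipath h' kx X -> sep h' (u' :: R' ++ B') X ->
     size R + size B < size R' + size B' -> force Q k h') ->
  force Q k.+1 h.
Proof.
move=> iR iB RB pwB iX sX Hk.
have pR := ipath_notin iR.
(* If [B] has at most one vertex, it is given up altogether: [R] gains [w] and [u], which outweighs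
   the loss, and [p] is the new common endpoint. *)
have short : size B <= 1 -> force Q k.+1 h.
  move=> sB; apply: (@force_leq _ k) => //; apply: (Hk h p [:: w, u & R] [::]) => //.
  - by apply: sep_sub sX _ _ => // x; rewrite cats0 /= !inE mem_cat => /or4P[]->;
      rewrite ?orbT.
  - by rewrite /=; lia.
case: B iB RB pwB sX Hk short => [|b' [|b B]] iB RB pwB sX Hk short; try exact: short.
clear short; set h' := fun d => rcons h ((p, b), d).
have wuRB : sep h [:: w, u & R] (b :: B).
  apply: sep_cons.
    by apply: sep_sub pwB _ _ => x; rewrite !inE => ->; rewrite ?orbT.
  apply: sep_cons; first exact: ipath_sep iB.
  by apply: sep_sub RB _ _ => // x; rewrite !inE => ->; rewrite ?orbT.
have pB : sep h [:: p] (b :: B).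
  by apply: sep_sub pwB _ _ => x; rewrite !inE => ->; rewrite ?orbT.
have npb : p != b.
  by have := sep_notin pB (mem_head _ _); rewrite inE negb_or => /andP[].
have pnB : p \notin b :: B by apply: sep_notin pB _; rewrite inE.
have bnR : b \notin [:: w, u & R].
  by apply: sep_notin (sep_sym wuRB) _; rewrite inE eqxx.
have iB2 : ipath h (~~ c) (b :: B) := ipath_behead (ipath_behead iB).
have bnB := ipath_notin iB2.
have pX : p \notin X by apply: (sep_notin sX); rewrite inE eqxx.
have bX : b \notin X by apply: (sep_notin sX); rewrite mem_cat !inE eqxx !orbT.
(* If [p b] gets color [c], then [b] becomes the common endpoint, [R] gains three vertices and the
   other path loses two. Otherwise [p] does, with a gain of two and a loss of one. *)
rewrite /=; right; exists (p, b) => [|d].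
  rewrite /legal_edge /= npb /=.
  by have := pB p b; rewrite !inE !eqxx => /(_ isT isT); rewrite negb_or => /andP[].
have iX' : ipath (h' d) kx X by apply: ipath_rcons iX => //=; rewrite (negPf pX).
have sX' s : {subset s <= [:: p, w, u & R] ++ [:: b', b & B]} -> sep (h' d) s X.
  move=> ss; apply: sep_rcons (sep_sub sX ss _) => //=; first by rewrite (negPf bX) andbF.
  by rewrite (negPf pX) andbF.
have [dc|dc] := boolP (d == c).
  apply: (Hk (h' d) b [:: p, w, u & R] B) => //.
  - apply: ipath_cons => //; first by rewrite eq_sym.
    + by rewrite colored_rcons (eqP dc) eqxx /edge_in !inE !eqxx !orbT.
    + apply: sep_rcons => //=; first by rewrite inE (negPf npb).
        by rewrite (negPf pR) andbF.
      by apply: sep_sub (sep_sym wuRB) _ _ => // x; rewrite !inE => ->.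
    + apply: ipath_rcons => //=.
      by rewrite [b \in _]inE eq_sym (negPf npb) (negPf bnR) andbF.
  - by apply: ipath_rcons => //=; rewrite (negPf pnB).
  - apply: sep_rcons => //=; first by rewrite (negPf bnB) andbF.
      by rewrite inE eq_sym (negPf npb) (negPf bnR).
    apply: sep_cons; first by apply: sep_sub pB _ _ => // x; rewrite !inE => ->; rewrite orbT.
    by apply: sep_sub wuRB _ _ => // x; rewrite !inE => ->; rewrite orbT.
  - apply: sX' => x; rewrite !(inE, mem_cat).
    by do ![case/orP]; move=> ->; rewrite ?orbT.
  - by rewrite /=; lia.
have {}dc : d = ~~ c by move: dc; case: (d); case: (c).
apply: (Hk (h' d) p [:: w, u & R] (b :: B)) => //.
- by apply: ipath_rcons => //=; rewrite [b \in _]inE eq_sym (negPf npb) (negPf bnR) andbF.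
- apply: ipath_cons => //.
  + by rewrite colored_rcons dc eqxx /edge_in !inE !eqxx !orbT.
  + apply: sep_rcons => //=; first by rewrite (negPf bnB) andbF.
      by rewrite inE eq_sym (negPf npb).
    by apply: sep_sub pB _ _ => // x; rewrite !inE => ->; rewrite orbT.
  + by apply: ipath_rcons => //=; rewrite (negPf pnB).
- apply: sep_rcons => //=; first by rewrite (negPf pR).
  by rewrite (negPf bnR).
- apply: sX' => x; rewrite !(inE, mem_cat).
  by do ![case/orP]; move=> ->; rewrite ?orbT.
- by rewrite /=; lia.
Qed.

(** The case in which Painter gave [u w] the color [c]: the neighbor [p] of [w] in that color
    completes an extension by two vertices. [X] is the remainder of the third path, which must stay
    separate. *)
Lemma attach_pair Q k h c u R B p w X kx :
  ipath h c (u :: R) -> ipath h (~~ c) (u :: B) -> sep h R B ->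
  p != w -> colored h c p w -> sep h (u :: R ++ B) [:: p; w] ->
  ipath h kx X -> sep h (u :: R ++ B) X -> sep h [:: p; w] X ->
  (forall h' u' R' B', ipath h' c (u' :: R') -> ipath h' (~~ c) (u' :: B') ->
     sep h' R' B' -> ipath h' kx X -> sep h' (u' :: R' ++ B') X ->
     size R + size B < size R' + size B' -> force Q k h') ->
  force Q k.+1 (rcons h ((u, w), c)).
Proof.
move=> iR iB RB pw cpw Spw iX SX pwX Hk.
have uS : u \in u :: R ++ B by rewrite inE eqxx.
have wnS : w \notin u :: R ++ B.
  by apply: sep_notin (sep_sym Spw) _; rewrite !inE eqxx orbT.
have pnS : p \notin u :: R ++ B.
  by apply: sep_notin (sep_sym Spw) _; rewrite !inE eqxx.
have wu : w != u by move: wnS; rewrite inE negb_or => /andP[].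
have uw : u != w by rewrite eq_sym.
have up : (u == p) = false by apply/negP=> /eqP E; rewrite -E uS in pnS.
have [wnR wnB] : w \notin u :: R /\ w \notin u :: B.
  by move: wnS; rewrite !inE mem_cat !negb_or => /and3P[-> -> ->].
have unR := ipath_notin iR; have unB := ipath_notin iB.
have uX := sep_notin SX uS.
have wX : w \notin X by apply: (sep_notin pwX); rewrite !inE eqxx orbT.
apply: (@grow_paths Q k _ c u R B p w X kx) => //.
- apply: ipath_cons => //; first by rewrite colored_rcons cpw.
    apply: sep_rcons => //=; first by rewrite inE up.
      by rewrite inE eq_sym (negPf pw).
    apply: sep_sub (sep_sym Spw) _ _ => x; rewrite !inE ?mem_cat; first by move->.
    by case/orP=> ->; rewrite ?orbT.
  apply: ipath_cons => //.
  + by rewrite colored_rcons eqxx /edge_in !inE !eqxx !orbT.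
  + apply: sep_rcons => //=; first by rewrite inE (negPf uw).
      by rewrite (negPf unR) andbF.
    apply: sep_sub (sep_sym Spw) _ _ => x; rewrite !inE ?mem_cat.
      by move->; rewrite orbT.
    by move->; rewrite !orbT.
  + by apply: ipath_rcons => //=; rewrite (negPf wnR) andbF.
- by apply: ipath_rcons => //=; rewrite (negPf wnB) andbF.
- apply: sep_rcons => //=; first by rewrite (negPf unR).
  by rewrite (negPf unB) andbF.
- apply: sep_rcons => //=; first by rewrite !inE up (negPf uw).
    by rewrite (negPf unB) andbF.
  apply: sep_sub (sep_sym Spw) _ _ => // x; rewrite !inE ?mem_cat.
  by move->; rewrite !orbT.
- by apply: ipath_rcons => //=; rewrite (negPf uX).
- apply: sep_rcons => //=; first by rewrite (negPf wX) andbF.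
    by rewrite (negPf uX) andbF.
  exact: (@sep_cat h [:: p; w] (u :: R ++ B)) pwX SX.
Qed.

(** Painter cannot prevent a gain: [w] has a neighbor in either color, so whichever color [u w]
    receives, the path of that color grows. At most two rounds are spent, on [u w] and on the edge
    of [grow_paths]. *)
Lemma attach_cherry Q k h c u R B p w q X kx :
  ipath h c (u :: R) -> ipath h (~~ c) (u :: B) -> sep h R B ->
  p != w -> colored h c p w -> q != w -> colored h (~~ c) q w ->
  sep h (u :: R ++ B) [:: p; w; q] ->
  ipath h kx X -> sep h (u :: R ++ B) X -> sep h [:: p; w; q] X ->
  (forall h' u' R' B', ipath h' c (u' :: R') -> ipath h' (~~ c) (u' :: B') ->
     sep h' R' B' -> ipath h' kx X -> sep h' (u' :: R' ++ B') X ->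
     size R + size B < size R' + size B' -> force Q k h') ->
  force Q k.+2 h.
Proof.
move=> iR iB RB pw cpw qw cqw Spwq iX SX pwqX Hk.
have uw : ~~ near h u w by apply: Spwq; rewrite !inE eqxx ?orbT.
right; exists (u, w) => [|d]; first by move: uw; rewrite negb_or.
have [/eqP->|dc] := boolP (d == c).
  apply: (@attach_pair _ _ h c u R B p w X kx) => //.
    by apply: sep_sub Spwq _ _ => // x; rewrite !inE => /orP[]->; rewrite ?orbT.
  by apply: sep_sub pwqX _ _ => // x; rewrite !inE => /orP[]->; rewrite ?orbT.
have {dc}-> : d = ~~ c by move: dc; case: (d); case: (c).
have BR : {subset u :: B ++ R <= u :: R ++ B}.
  by move=> x; rewrite !inE !mem_cat orbA orbAC -orbA.
apply: (@attach_pair _ _ h (~~ c) u B R q w X kx) => //.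
- by rewrite negbK.
- exact: sep_sym.
- by apply: sep_sub Spwq BR _ => // x; rewrite !inE => /orP[]->; rewrite ?orbT.
- exact: sep_sub SX BR _.
- by apply: sep_sub pwqX _ _ => // x; rewrite !inE => /orP[]->; rewrite ?orbT.
move=> h' u' R' B' iR' iB' RB' iX' SX' lt; rewrite negbK in iB'.
apply: (Hk h' u' B' R') => //; last by lia.
- exact: sep_sym.
- by apply: sep_sub SX' _ _ => // x; rewrite !inE !mem_cat orbA orbAC -orbA.
Qed.

Lemma fresh_sep h s : exists y, sep h s [:: y].
Proof.
(* The vertices of [s] may be isolated and lie beyond [vbound h], hence the second term. *)
exists (maxn (vbound h) (\max_(x <- s) x).+1) => x y xs; rewrite inE => /eqP->.
rewrite near_sym negb_or adj_ge ?leq_maxl // andbT neq_ltn orbC.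
by rewrite (big_rem x) //=; lia.
Qed.

Definition has_ipath K h := exists c s, ipath h c s /\ size s = K.

Lemma has_ipath_geq K h c s : ipath h c s -> K <= size s -> has_ipath K h.
Proof.
move=> is_ le; exists c, (drop (size s - K) s); split; first exact: ipath_drop.
by rewrite size_drop subKn.
Qed.

(** The bound is a potential. A color change along [X] costs at most three rounds and three vertices
    of [X], hence six units, and raises [size R + size B] by at least one; a round without color
    change lengthens [X] by one. *)
Lemma force_ipath_from K f h c u R B X kx :
  ipath h c (u :: R) -> ipath h (~~ c) (u :: B) -> sep h R B ->
  ipath h kx X -> sep h (u :: R ++ B) X ->
  6 * (2 * K - (size R + size B)) + (K - size X) <= f ->
  force (has_ipath K) f h.
Proof.
elim/ltn_ind: f h u R B X kx => f IH h u R B X kx iR iB RB.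
wlog: X kx / exists x X', X = x :: X'.
  move=> W iX SX; case: X iX SX => [|x X] iX SX; last by apply: (W _ kx) => //; exists x, X.
  have [x Sx] := fresh_sep h (u :: R ++ B).
  by move=> H; apply: (W [:: x] kx) => //; [exists x, [::] | rewrite /= in H *; lia].
case=> x [X' ->] iX SX Hf.
have [leX|ltX] := leqP K (size (x :: X')); first exact: force_now (has_ipath_geq iX leX).
have [leR|ltR] := leqP K (size (u :: R)); first exact: force_now (has_ipath_geq iR leR).
have [leB|ltB] := leqP K (size (u :: B)); first exact: force_now (has_ipath_geq iB leB).
rewrite /= in ltX ltR ltB Hf.
have [y Sy] := fresh_sep h (u :: R ++ B ++ x :: X').
have sub1 : {subset u :: R ++ B <= u :: R ++ B ++ x :: X'}.
  by move=> z; rewrite !inE !mem_cat => /or3P[]->; rewrite ?orbT.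
have sub2 : {subset x :: X' <= u :: R ++ B ++ x :: X'}.
  by move=> z zX; rewrite in_cons !mem_cat zX !orbT.
have ynX : y \notin x :: X'.
  by apply/negP => /sub2 /(sep_notin Sy); rewrite inE eqxx.
have ynS : y \notin u :: R ++ B.
  by apply/negP => /sub1 /(sep_notin Sy); rewrite inE eqxx.
have xnS : x \notin u :: R ++ B.
  by apply: sep_notin (sep_sym SX) _; rewrite inE eqxx.
have nxy : x != y by move: ynX; rewrite inE negb_or eq_sym => /andP[].
have nyx : y != x by rewrite eq_sym.
case: f IH Hf => [|f] IH Hf; first lia.
right; exists (x, y) => [|d].
  by rewrite /legal_edge nxy; have := Sy x y; rewrite !inE mem_cat mem_cat mem_head
    !orbT !eqxx => /(_ isT isT); rewrite negb_or => /andP[].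
set h' := rcons h _.
have cxy : colored h' d y x by rewrite colored_rcons eqxx /edge_in !inE !eqxx !orbT.
have {}iR : ipath h' c (u :: R).
  apply: ipath_rcons iR => //; apply/negP => /andP[/= _ yR]; case/negP: ynS.
  by move: yR; rewrite !inE mem_cat => /orP[]->; rewrite ?orbT.
have {}iB : ipath h' (~~ c) (u :: B).
  apply: ipath_rcons iB => //; apply/negP => /andP[/= _ yR]; case/negP: ynS.
  by move: yR; rewrite !inE mem_cat => /orP[]->; rewrite ?orbT.
have {}RB : sep h' R B.
  apply: sep_rcons RB => //=; apply/negP => /andP[y1 y2]; case/negP: ynS;
  by rewrite inE mem_cat ?y1 ?y2 ?orbT.
have SyX : sep h' (u :: R ++ B) [:: y, x & X'].
  apply: sep_rcons => //=; first by rewrite (negPf xnS).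
    by rewrite (negPf ynS).
  by apply: sep_sym; apply: sep_cons; apply: sep_sym => //; apply: sep_sub Sy _ _.
(* A single vertex is a path of either color, so its first edge never counts as a color change. *)
case: X' iX SX Hf ltX Sy sub1 sub2 ynX SyX => [|p X'] iX SX Hf ltX Sy sub1 sub2 ynX SyX.
  apply: (IH f _ h' u R B [:: y; x] d) => //=.
    by rewrite nyx cxy.
  by rewrite /= in Hf ltX; lia.
rewrite /= in Hf ltX.
have iX' : ipath h' kx [:: x, p & X'] by apply: ipath_rcons iX => //=; rewrite (negPf ynX) andbF.
have ypX : sep h' [:: y] (p :: X').
  apply: sep_rcons => //=; first by rewrite inE (negPf nxy).
    by rewrite (negPf (ipath_notin iX)) andbF.
  apply: sep_sub (sep_sym Sy) _ _ => // z zX; apply: sub2.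
  by rewrite inE zX orbT.
have [dk|dk] := boolP (d == kx).
  apply: (IH f _ h' u R B [:: y, x, p & X'] d) => //; last by rewrite /=; lia.
  by apply: ipath_cons => //; rewrite (eqP dk).
have {}dk : d = ~~ kx by move: dk; case: (d); case: (kx).
have [px cpx] : p != x /\ colored h' kx p x.
  by case/andP: iX' => /and3P[]; rewrite eq_sym colored_sym.
have iX2 := ipath_behead iX'.
(* The vertex after [p] is adjacent to [p] and has to go, so [behead X'] is what remains of the
   third path. *)
have iX3 : ipath h' kx (behead X').
  by case: (X') (ipath_behead iX2) => // a s /ipath_behead.
have bsub : {subset behead X' <= X'} by move=> z; apply: mem_behead.
have xpX : sep h' [:: x] X' := ipath_sep iX'.
have ppX : sep h' [:: p] (behead X').
  by case: (X') iX2 => [|a s] /= i2; [move=> ? ? | apply: ipath_sep i2].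
(* The edges [p x] and [y x] have opposite colors; [key] serves both ways of matching them with
   [c]. *)
have key p' q' : p' != x -> q' != x -> colored h' c p' x -> colored h' (~~ c) q' x ->
   {subset [:: p'; q'] <= [:: p; y]} -> force (has_ipath K) f h'.
  move=> p'x q'x cp cq s2.
  have s3 : {subset [:: p'; x; q'] <= [:: p; x; y]}.
    move=> z; rewrite !inE => /or3P[] /eqP->; rewrite ?eqxx ?orbT //.
      by have := s2 p'; rewrite !inE eqxx => /(_ isT) /orP[]->; rewrite ?orbT.
    by have := s2 q'; rewrite !inE eqxx orbT => /(_ isT) /orP[]->; rewrite ?orbT.
  have f2 : (f - 2).+2 = f by clear -Hf ltX ltR ltB; lia.
  rewrite -f2.
  apply: (@attach_cherry _ _ h' c u R B p' x q' (behead X') kx) => //.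
  - apply: sep_sub SyX _ _ => // z /s3; rewrite !inE => /or3P[]->; rewrite ?orbT //.
  - by apply: sep_sub SyX _ _ => // z /bsub zX; rewrite !inE zX !orbT.
  - apply: sep_sub _ s3 (fun _ H => H); apply: sep_cons => //.
    apply: sep_cons; first exact: sep_sub xpX _ bsub.
    by apply: sep_sub ypX _ _ => // z /bsub zX; rewrite !inE zX !orbT.
  move=> h2 u' R' B' iR' iB' RB' iX3' SX' lt.
  apply: (IH (f - 2) _ h2 u' R' B' (behead X') kx) => //; first by clear -f2; lia.
  by rewrite size_behead; clear -Hf ltX ltR ltB lt; lia.
have [kc|kc] := boolP (kx == c).
  apply: (key p y) => //; first by rewrite -(eqP kc).
  by rewrite -(eqP kc) -dk.
have {}kc : kx = ~~ c by move: kc; case: (kx); case: (c).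
apply: (key y p) => //.
- by rewrite -[c]negbK -kc -dk.
- by rewrite -kc.
- by move=> z; rewrite !inE orbC.
Qed.

(** With [R], [B] and [X] empty, the potential is [6 * (2 * K) + K]. *)
Lemma force_ipath K : force (has_ipath K) (13 * K) [::].
Proof.
by apply: (@force_ipath_from K _ [::] true 0 [::] [::] [::] true) => //=; lia.
Qed.

(** * Copies of cycles *)

Lemma ipath_nth h c s i j : ipath h c s -> i < j < size s ->
  [/\ nth 0 s i != nth 0 s j,
      background_adj h (nth 0 s i) (nth 0 s j) = (j == i.+1) &
      j = i.+1 -> colored h c (nth 0 s i) (nth 0 s j)].
Proof.
elim: s i j => [|x s IH] i j; first by rewrite ltn0 andbF.
case: i j => [|i] [|j] //= /andP[Hx Hs] lt; last first.
  by case: (IH i j Hs lt) => H1 H2 H3; split=> // -[/H3].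
case: s {IH Hs} Hx lt => // y s /and3P[xy cxy /allP Hn].
case: j => [|j] lt /=; first by rewrite (colored_adj xy cxy).
by have := Hn (nth 0 s j) (mem_nth _ lt); rewrite negb_or => /andP[-> /negPf->].
Qed.

(* Only meaningful for [i < j]. *)
Definition ring_adj n i j := (j == i.+1) || ((i == 0) && (j == n.-1)).

Lemma cycle_adj_ring n (i j : 'I_n) : i < j -> cycle_adj i j = ring_adj n i j.
Proof.
move=> ltij; rewrite /cycle_adj /ring_adj -!(inj_eq val_inj) /=.
have := ltn_ord j; rewrite leq_eqVlt => /orP[/eqP jn|jn]; last first.
  by rewrite !modn_small; lia.
by rewrite jn modnn modn_small; lia.
Qed.

(** All cycles found below, of either color, are certified by this criterion; symmetry reduces it to
    pairs [i < j]. *)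
Lemma cycle_copy h c n (f : nat -> nat) :
  (forall i j, i < j < n ->
     [/\ f i != f j, background_adj h (f i) (f j) = ring_adj n i j &
         ring_adj n i j -> colored h c (f i) (f j)]) ->
  mono_induced_copy h (cycle_graph n).
Proof.
move=> Hf; pose S : pred nat := fun u => [exists i : 'I_n, u == f i].
have fS (i : 'I_n) : S (f i) by apply/existsP; exists i.
have fI (i j : 'I_n) : f i = f j -> i = j.
  move=> E; apply: val_inj => /=.
  case: (ltngtP i j) => // lt; [have [] := Hf i j | have [] := Hf j i];
    by rewrite ?lt ?ltn_ord //= E eqxx.
exists S; split.
  have inv (x : {x : nat | S x}) : exists i : 'I_n, sval x == f i.
    by case: x => x /= /existsP.
  pose r (x : {x : nat | S x}) : 'I_n := xchoose (inv x).
  have rE x : sval x = f (r x) by apply/eqP; exact: (xchooseP (inv x)).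
  exists (r : @induced (background h) S -> cycle_graph n); split.
    exists (fun i : 'I_n => exist _ (f i) (fS i)) => [x|i].
      by apply: val_inj; rewrite /= -rE.
    by apply: fI; rewrite -rE.
  move=> x y; rewrite /= /induced_adj /= !rE.
  move: (r x) (r y) => i j; case: (ltngtP i j) => lt.
  - by rewrite cycle_adj_ring //; case: (Hf i j) => [|_ ->]; rewrite // lt /=.
  - rewrite cycle_adj_sym cycle_adj_ring // adjC.
    by case: (Hf j i) => [|_ ->]; rewrite // lt /=.
  - by rewrite (val_inj lt) cycle_adj_irr adj_irrefl.
exists c => _ _ /existsP[i /eqP->] /existsP[j /eqP->].
case: (ltngtP i j) => lt.
- by case: (Hf i j) => [|_ -> H /H]; rewrite ?lt /=.
- by rewrite adjC colored_sym; case: (Hf j i) => [|_ -> H /H]; rewrite ?lt /=.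
- by rewrite (val_inj lt) adj_irrefl.
Qed.

(** * Chords of a long path *)

Definition zig q k := ((k + 3) %% 4) * (2 * q) + k.

(* With [N = n - 2 = 2 q], consecutive values differ by [N + 1] or [3 N - 1].
   The walk [4 N + zig q k], for [k < q], repeats one step [1 - 3 N] and three
   steps [N + 1]; its translate by [- 4 N] is traversed backwards, and the two
   remaining values join the ends. *)
Definition zigzag q k :=
  if k < q then 8 * q + zig q k
  else if k == q then (1 + (q + 2) %% 4) * (2 * q) + q
  else if k <= 2 * q then zig q (2 * q - k) else (12 * q).-1.

(** On each residue class modulo 4 the walk is affine in [k], which brings its comparisons within
    reach of [lia]. *)
Lemma zigE q k : exists a,
  [\/ k = 4 * a /\ zig q k = 6 * q + k,
      k = 4 * a + 1 /\ zig q k = k,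
      k = 4 * a + 2 /\ zig q k = 2 * q + k |
      k = 4 * a + 3 /\ zig q k = 4 * q + k].
Proof.
exists (k %/ 4); rewrite /zig.
have /or4P : [|| k %% 4 == 0, k %% 4 == 1, k %% 4 == 2 | k %% 4 == 3] by lia.
case=> /eqP E; [apply: Or41; have -> : (k + 3) %% 4 = 3 by lia
  | apply: Or42; have -> : (k + 3) %% 4 = 0 by lia
  | apply: Or43; have -> : (k + 3) %% 4 = 1 by lia
  | apply: Or44; have -> : (k + 3) %% 4 = 2 by lia]; lia.
Qed.

(** The value at [k = q] lies [3 N - 1] below its predecessor [8 * q + zig q q.-1] and [N + 1] above
    its successor [zig q q.-1]; this dictates the formula. *)
Lemma turnE q : exists a,
  [\/ q = 4 * a /\ (1 + (q + 2) %% 4) * (2 * q) + q = 7 * q,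
      q = 4 * a + 1 /\ (1 + (q + 2) %% 4) * (2 * q) + q = 9 * q,
      q = 4 * a + 2 /\ (1 + (q + 2) %% 4) * (2 * q) + q = 3 * q |
      q = 4 * a + 3 /\ (1 + (q + 2) %% 4) * (2 * q) + q = 5 * q].
Proof.
exists (q %/ 4).
have /or4P : [|| q %% 4 == 0, q %% 4 == 1, q %% 4 == 2 | q %% 4 == 3] by lia.
case=> /eqP E; [apply: Or41; have -> : (q + 2) %% 4 = 2 by lia
  | apply: Or42; have -> : (q + 2) %% 4 = 3 by lia
  | apply: Or43; have -> : (q + 2) %% 4 = 0 by lia
  | apply: Or44; have -> : (q + 2) %% 4 = 1 by lia]; lia.
Qed.

Variant zigzag_spec q k : nat -> Prop :=
  | ZigzagUp z of k < q & zig q k = z : zigzag_spec q k (8 * q + z)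
  | ZigzagTurn z of k = q & (1 + (q + 2) %% 4) * (2 * q) + q = z : zigzag_spec q k z
  | ZigzagDown z of q < k <= 2 * q & zig q (2 * q - k) = z : zigzag_spec q k z
  | ZigzagEnd of 2 * q < k : zigzag_spec q k (12 * q).-1.

Lemma zigzagP q k : zigzag_spec q k (zigzag q k).
Proof.
rewrite /zigzag; case: ltnP => [lt|ge]; first exact: ZigzagUp.
case: eqP => [e|ne]; first exact: ZigzagTurn.
by case: leqP => le; [apply: ZigzagDown; lia | apply: ZigzagEnd].
Qed.

Lemma zigzag_bound q k : 0 < q -> k < 2 * q + 2 -> zigzag q k + 2 <= 16 * q.
Proof.
move=> q0 kn; case: zigzagP => [z kq zk|z kq zk|z kq zk|kq]; last lia.
- by have [a] := zigE q k; rewrite zk => -[] [? ?]; lia.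
- by have [a] := turnE q; rewrite zk => -[] [? ?]; lia.
- by have [a] := zigE q (2 * q - k); rewrite zk => -[] [? ?]; lia.
Qed.

Ltac zigzag_cases Hi Hj := case: Hi => -[? ?]; case: Hj => -[? ?]; lia.

(** A gap of two excludes edges of the path itself between vertices of the zigzag cycle, as its
    inducedness requires. *)
Lemma zigzag_gap q i j : 0 < q -> i < j < 2 * q + 2 ->
  (zigzag q i + 2 <= zigzag q j) || (zigzag q j + 2 <= zigzag q i).
Proof.
move=> q0 /andP[ij jn].
case: (zigzagP q i) => [z iq zi|z iq zi|z iq zi|iq]; last lia.
- have [a] := zigE q i; rewrite zi => Hi.
  case: (zigzagP q j) => [y jq yj|y jq yj|y jq yj|jq].
  + by have [b] := zigE q j; rewrite yj => Hj; zigzag_cases Hi Hj.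
  + by have [b] := turnE q; rewrite yj => Hj; zigzag_cases Hi Hj.
  + by have [b] := zigE q (2 * q - j); rewrite yj => Hj; zigzag_cases Hi Hj.
  + by case: Hi => -[? ?]; lia.
- have [a] := turnE q; rewrite zi => Hi.
  case: (zigzagP q j) => [y jq yj|y jq yj|y jq yj|jq]; try lia.
  + by have [b] := zigE q (2 * q - j); rewrite yj => Hj; zigzag_cases Hi Hj.
  + by case: Hi => -[? ?]; lia.
- have [a] := zigE q (2 * q - i); rewrite zi => Hi.
  case: (zigzagP q j) => [y jq yj|y jq yj|y jq yj|jq]; try lia.
  + by have [b] := zigE q (2 * q - j); rewrite yj => Hj; zigzag_cases Hi Hj.
  + by case: Hi => -[? ?]; lia.
Qed.

Lemma zigzag_step q i j : 0 < q -> i < j < 2 * q + 2 -> ring_adj (2 * q + 2) i j ->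
  [|| zigzag q j == zigzag q i + 2 * q + 1, zigzag q i == zigzag q j + 2 * q + 1,
      zigzag q j + 1 == zigzag q i + 6 * q | zigzag q i + 1 == zigzag q j + 6 * q].
Proof.
rewrite /ring_adj => q0 /andP[ij jn] Hr.
have {}Hr : j = i.+1 \/ i = 0 /\ j = 2 * q + 1 by lia.
case: (zigzagP q i) => [z iq zi|z iq zi|z iq zi|iq]; last lia.
- have [a] := zigE q i; rewrite zi => Hi.
  case: (zigzagP q j) => [y jq yj|y jq yj|y jq yj|jq].
  + by have [b] := zigE q j; rewrite yj => Hj; zigzag_cases Hi Hj.
  + by have [b] := turnE q; rewrite yj => Hj; zigzag_cases Hi Hj.
  + by have [b] := zigE q (2 * q - j); rewrite yj => Hj; zigzag_cases Hi Hj.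
  + by case: Hi => -[? ?]; lia.
- have [a] := turnE q; rewrite zi => Hi.
  case: (zigzagP q j) => [y jq yj|y jq yj|y jq yj|jq]; try lia.
  by have [b] := zigE q (2 * q - j); rewrite yj => Hj; zigzag_cases Hi Hj.
- have [a] := zigE q (2 * q - i); rewrite zi => Hi.
  case: (zigzagP q j) => [y jq yj|y jq yj|y jq yj|jq]; try lia.
  + by have [b] := zigE q (2 * q - j); rewrite yj => Hj; zigzag_cases Hi Hj.
  + by case: Hi => -[? ?]; lia.
Qed.

Definition ring_edges n := (0, n.-1) :: [seq (k, k.+1) | k <- iota 0 n.-1].

Lemma size_ring_edges n : 0 < n -> size (ring_edges n) = n.
Proof. by move=> n0; rewrite /= size_map size_iota prednK. Qed.

Lemma mem_ring_edges n i j : 1 < n ->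
  ((i, j) \in ring_edges n) = (i < j < n) && ring_adj n i j.
Proof.
move=> n1; rewrite inE xpair_eqE /ring_adj.
have -> : ((i, j) \in [seq (k, k.+1) | k <- iota 0 n.-1]) = (i < n.-1) && (j == i.+1).
  apply/mapP/andP => [[k]|[lt /eqP->]]; last by exists i => //; rewrite mem_iota.
  by rewrite mem_iota => lt [-> ->]; rewrite eqxx.
lia.
Qed.

(* The three copies lie in the three thirds, of [16 q = 8 N] vertices each, of a
   path with [48 q] vertices. *)
Definition chords q : seq (nat * nat) :=
  [seq (16 * q * r + zigzag q e.1, 16 * q * r + zigzag q e.2)
     | r <- iota 0 3, e <- ring_edges (2 * q + 2)].

Lemma size_chords q : size (chords q) = 3 * (2 * q + 2).
Proof. by rewrite size_allpairs size_iota size_ring_edges //; lia. Qed.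

Lemma mem_chords q a b : (a, b) \in chords q ->
  exists r i j, [/\ r < 3, (i < j < 2 * q + 2) && ring_adj (2 * q + 2) i j,
    a = 16 * q * r + zigzag q i & b = 16 * q * r + zigzag q j].
Proof.
case/allpairsP=> [[r [i j]]] [r3 e [-> ->]]; exists r, i, j; split=> //.
  by rewrite mem_iota in r3.
by rewrite -mem_ring_edges //; lia.
Qed.

(** Both lengths are odd, so no chord joins vertices of equal parity, and no chord leaves its
    third. *)
Lemma chord_dist q a b : 0 < q -> a < b -> edge_in (chords q) a b ->
  exists2 r, r < 3 & [/\ 16 * q * r <= a, b + 2 <= 16 * q * r + 16 * q &
    b = a + (2 * q).+1 \/ b = a + (6 * q).-1].
Proof.
move=> q0 ab /orP[] /mem_chords[r [i [j [r3 /andP[ijn Hr] Ea Eb]]]]; exists r => //;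
  have Bi : zigzag q i + 2 <= 16 * q by [apply: zigzag_bound; lia];
  have Bj : zigzag q j + 2 <= 16 * q by [apply: zigzag_bound; lia];
  have := zigzag_step q0 ijn Hr; split; lia.
Qed.

Lemma zigzag_inj q i j : 0 < q -> i < 2 * q + 2 -> j < 2 * q + 2 ->
  zigzag q i = zigzag q j -> i = j.
Proof.
move=> q0 lti ltj E; case: (ltngtP i j) => // lt.
  by have := @zigzag_gap q i j q0; rewrite lt ltj => /(_ isT); lia.
by have := @zigzag_gap q j i q0; rewrite lt lti => /(_ isT); lia.
Qed.

Lemma chord_zigzag q r i j : 0 < q -> r < 3 -> i < j < 2 * q + 2 ->
  edge_in (chords q) (16 * q * r + zigzag q i) (16 * q * r + zigzag q j) =
  ring_adj (2 * q + 2) i j.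
Proof.
move=> q0 r3 ijn; apply/idP/idP => [|Hr]; last first.
  apply/orP; left; apply/allpairsP; exists (r, (i, j)); split => //.
    by rewrite mem_iota.
  by rewrite mem_ring_edges ?ijn //; lia.
have lti : i < 2 * q + 2 by lia.
have ltj : j < 2 * q + 2 by lia.
have Bi := zigzag_bound q0 lti; have Bj := zigzag_bound q0 ltj.
case/orP => /mem_chords[r' [k [l [r'3 /andP[kln Hr] Ea Eb]]]];
  have ltk : k < 2 * q + 2 by [lia];
  have ltl : l < 2 * q + 2 by [lia];
  have Bk := zigzag_bound q0 ltk; have Bl := zigzag_bound q0 ltl;
  have Er : r = r' by [nia]; subst r'.
  have -> : i = k by apply: (zigzag_inj q0) => //; lia.
  by have -> : j = l by apply: (zigzag_inj q0) => //; lia.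
(* The reversed orientation would give [j < i]. *)
have Ek : i = l by apply: (zigzag_inj q0) => //; lia.
have El : j = k by apply: (zigzag_inj q0) => //; lia.
lia.
Qed.

(** * The path with its chords, and red cycles of length [6 * q]. Here red stands for [c] *)

Definition board q h c (v : nat -> nat) : Prop :=
  [/\ forall i j, i < j < 48 * q -> v i != v j,
      forall i j, i < j < 48 * q ->
        background_adj h (v i) (v j) = (j == i.+1) || edge_in (chords q) i j &
      forall i, i.+1 < 48 * q -> colored h c (v i) (v i.+1)].

Lemma board_short_chord q h c v i : 0 < q -> board q h c v ->
  i + (2 * q).+1 < 48 * q -> edge_in (chords q) i (i + (2 * q).+1) ->
  colored h c (v i) (v (i + (2 * q).+1)) ->
  mono_induced_copy h (cycle_graph (2 * q + 2)).
Proof.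
move=> q0 [vI vA vC] lti Hi ci.
apply: (@cycle_copy h c _ (fun k => v (i + k))) => k l kl; split.
- by apply: vI; lia.
- rewrite vA /ring_adj; last by lia.
  have [->|nlk] := eqVneq l k.+1; first by rewrite addnS eqxx.
  have [/andP[/eqP-> /eqP El]|ne] := boolP ((k == 0) && (l == (2 * q + 2).-1)).
    have -> : l = (2 * q).+1 by lia.
    by rewrite addn0 Hi orbT.
  (* A window of [2 * q + 2] consecutive vertices has room for one chord only, the one joining its
     ends. *)
  have -> : edge_in (chords q) (i + k) (i + l) = false.
    apply/negP => /(chord_dist q0) []; [lia | move=> r r3 [_ _]; lia].
  by rewrite orbF; lia.
- rewrite /ring_adj => /orP[/eqP->|/andP[/eqP-> /eqP->]].
    by rewrite addnS; apply: vC; lia.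
  by rewrite addn0; have -> : (2 * q + 2).-1 = (2 * q).+1 by lia.
Qed.

Lemma board_zigzag q h c v r : 0 < q -> board q h c v -> r < 3 ->
  (forall i j, i < j < 2 * q + 2 -> ring_adj (2 * q + 2) i j ->
    colored h (~~ c) (v (16 * q * r + zigzag q i)) (v (16 * q * r + zigzag q j))) ->
  mono_induced_copy h (cycle_graph (2 * q + 2)).
Proof.
move=> q0 [vI vA vC] r3 Hc.
apply: (@cycle_copy h (~~ c) _ (fun k => v (16 * q * r + zigzag q k))) => i j ijn.
have Bi : zigzag q i + 2 <= 16 * q by apply: zigzag_bound; lia.
have Bj : zigzag q j + 2 <= 16 * q by apply: zigzag_bound; lia.
have B3 : 16 * q * r <= 16 * q * 2 by rewrite leq_mul2l; lia.
have /orP[G|G] := zigzag_gap q0 ijn; split; try exact: Hc.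
- by apply: vI; lia.
- by rewrite vA; [rewrite chord_zigzag //; lia | lia].
- by rewrite eq_sym; apply: vI; lia.
- rewrite adjC vA; last lia.
  have -> : edge_in (chords q) (16 * q * r + zigzag q j) (16 * q * r + zigzag q i)
    = ring_adj (2 * q + 2) i j by rewrite /edge_in orbC; apply: chord_zigzag.
  by lia.
Qed.

(** An arc with [2 * q + 1] vertices of the red cycle is an induced path: indices of two of its
    vertices differ by at most [2 * q], or by at least [4 * q] if the closing chord lies between
    them. So no chord of length [2 * q + 1] occurs, and one of length [6 * q - 1] only as the
    closing chord. *)
Lemma board_red_arc q h c v b s k l : 0 < q -> board q h c v ->
  b + 6 * q <= 48 * q -> edge_in (chords q) b (b + (6 * q).-1) ->
  colored h c (v b) (v (b + (6 * q).-1)) -> s < 6 * q -> k < l <= 2 * q ->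
  let a x := v (b + (s + x) %% (6 * q)) in
  [/\ a k != a l, background_adj h (a k) (a l) = (l == k.+1) &
      l = k.+1 -> colored h c (a k) (a l)].
Proof.
move=> q0 [vI vA vC] ltb Hb cb lts kl /=.
have mE x : x <= 2 * q -> (s + x) %% (6 * q) = if s + x < 6 * q then s + x else s + x - 6 * q.
  move=> le; case: ltnP => lt; first by rewrite modn_small.
  by rewrite -[in LHS](subnK lt) modnDr modn_small; lia.
have nochord x y : x < y -> y < x + (6 * q).-1 -> y != x + (2 * q).+1 ->
    edge_in (chords q) x y = false.
  by move=> xy lt ne; apply/negP => /(chord_dist q0 xy) [r _ [_ _]]; lia.
rewrite !mE; [|lia..].
have [ltk|gek] := ltnP (s + k) (6 * q); have [ltl|gel] := ltnP (s + l) (6 * q); try lia.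
- split; first by apply: vI; lia.
    by rewrite vA ?nochord; lia.
  by move=> ->; rewrite !addnS; apply: vC; lia.
- have lt : b + (s + l - 6 * q) < b + (s + k) < 48 * q by lia.
  split; first by rewrite eq_sym; apply: vI.
    rewrite adjC vA //.
    have [El|ne] := eqVneq l k.+1.
      have -> : s + l - 6 * q = 0 by lia.
      have -> : s + k = (6 * q).-1 by lia.
      by rewrite addn0 Hb orbT.
    by rewrite nochord; lia.
  move=> El; rewrite colored_sym.
  have -> : s + l - 6 * q = 0 by lia.
  have -> : s + k = (6 * q).-1 by lia.
  by rewrite addn0.
- split; first by apply: vI; lia.
    by rewrite vA ?nochord; lia.
  move=> El; have -> : b + (s + l - 6 * q) = (b + (s + k - 6 * q)).+1 by lia.
  by apply: vC; lia.
Qed.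

Lemma board_red_pair q h c v b s y : 0 < q -> board q h c v ->
  b + 6 * q <= 48 * q -> edge_in (chords q) b (b + (6 * q).-1) ->
  colored h c (v b) (v (b + (6 * q).-1)) -> s < 6 * q ->
  (forall x, x <= 2 * q -> y != v (b + (s + x) %% (6 * q))) ->
  (forall x, x <= 2 * q -> background_adj h y (v (b + (s + x) %% (6 * q))) =
     (x == 0) || (x == 2 * q)) ->
  colored h c y (v (b + s)) ->
  colored h c y (v (b + (s + 2 * q) %% (6 * q))) ->
  mono_induced_copy h (cycle_graph (2 * q + 2)).
Proof.
move=> q0 Hb ltb eb cb lts yne yA cy0 cy1.
pose f k := if k is k'.+1 then v (b + (s + k') %% (6 * q)) else y.
apply: (@cycle_copy h c _ f) => -[|k] [|l] //= kl; last first.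
  have [|H1 H2 H3] := @board_red_arc q h c v b s k l q0 Hb ltb eb cb lts; first lia.
  split=> //; first by rewrite H2 /ring_adj; lia.
  by rewrite /ring_adj => H; apply: H3; lia.
split; first by apply: yne; lia.
  by rewrite yA /ring_adj; lia.
rewrite /ring_adj => /orP[/eqP[->]|/andP[_ /eqP El]].
  by rewrite addn0 modn_small.
by have -> : l = 2 * q by lia.
Qed.

Lemma region_uniq q r r' x : 16 * q * r <= x < 16 * q * r + 16 * q ->
  16 * q * r' <= x < 16 * q * r' + 16 * q -> r = r'.
Proof. nia. Qed.

Lemma board_region q h c v r : 0 < q -> board q h c v -> r < 3 ->
  mono_induced_copy h (cycle_graph (2 * q + 2)) \/
  exists b, [/\ 16 * q * r <= b, b + 6 * q < 16 * q * r + 16 * q,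
    edge_in (chords q) b (b + (6 * q).-1) & colored h c (v b) (v (b + (6 * q).-1))].
Proof.
move=> q0 Hb r3.
have [?|nocopy] := pselect (mono_induced_copy h (cycle_graph (2 * q + 2))); first by left.
(* Without a long red chord in this third, every step of its zigzag is blue. *)
right; apply: contrapT => nored; apply: (nocopy).
apply: (board_zigzag q0 Hb r3) => i j ijn Hr.
set x := _ + zigzag q i; set z := _ + zigzag q j.
have Bi : zigzag q i + 2 <= 16 * q by apply: zigzag_bound; lia.
have Bj : zigzag q j + 2 <= 16 * q by apply: zigzag_bound; lia.
have B3 : 16 * q * r <= 16 * q * 2 by rewrite leq_mul2l; lia.
have step := zigzag_step q0 ijn Hr.
have exz : edge_in (chords q) x z by rewrite chord_zigzag.
have red x' z' : x' < z' -> 16 * q * r <= x' -> z' + 2 <= 16 * q * r + 16 * q ->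
    edge_in (chords q) x' z' -> z' = x' + (2 * q).+1 \/ z' = x' + (6 * q).-1 ->
    colored h (~~ c) (v x') (v z').
  move=> lt ge le exz' dist; case: (Hb) => _ vA _.
  have : background_adj h (v x') (v z') by rewrite vA ?exz' ?orbT //; lia.
  case/(@adj_colored _ _ _ c) => // cc; case: dist => Ez; rewrite Ez in cc exz'.
    by case: nocopy; apply: (board_short_chord q0 Hb _ exz' cc); lia.
  by case: nored; exists x'; split=> //; lia.
have [xz|zx] : x < z \/ z < x by have := zigzag_gap q0 ijn; rewrite /x /z; lia.
  by apply: red => //; rewrite /x /z; lia.
have ezx : edge_in (chords q) z x by rewrite /edge_in orbC.
by rewrite colored_sym; apply: red => //; rewrite /x /z; lia.
Qed.

(** * Triples on red cycles *)

Section Spokes.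

Variables (q : nat) (b : nat -> nat).

(** The classes [0, ..., q] are arranged cyclically. Alternating between two red cycles fails at the
    closure when [q] is even, so class [q] gets the third cycle. *)
Definition region j := if j == q then 2 else j %% 2.

Definition next_class j := if j == q then 0 else j.+1.

(** The offsets are even and below [2 * q], so triples are disjoint and spokes on one red cycle have
    even distance. *)
Definition spoke j t := b (region j) + (if j == q then 0 else 2 * j) + t * (2 * q).

Definition triple j := [:: spoke j 0; spoke j 1; spoke j 2].

Definition spokes (v : nat -> nat) M : seq (nat * nat) :=
  [seq (M + j, v a) | j <- iota 0 q.+1, a <- triple j ++ triple (next_class j)].

Lemma size_spokes v M : size (spokes v M) = 6 * q.+1.
Proof.
rewrite size_allpairs_dep -[X in _ = 6 * X](size_iota 0 q.+1).
by elim: (iota 0 q.+1) => //= j s ->; lia.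
Qed.

Lemma mem_spokes v M x z : reflect
  (exists j a, [/\ j <= q, a \in triple j ++ triple (next_class j), x = M + j & z = v a])
  ((x, z) \in spokes v M).
Proof.
apply: (iffP allpairsPdep) => [[j [a [jq aj [-> ->]]]]|[j [a [jq aj -> ->]]]].
  by exists j, a; split=> //; move: jq; rewrite mem_iota.
by exists j, a; split=> //; rewrite mem_iota.
Qed.

Lemma region_lt3 j : region j < 3.
Proof. by rewrite /region; case: eqP => _ //; lia. Qed.

Hypothesis q_gt0 : 0 < q.
Hypothesis b_region : forall r, r < 3 ->
  (16 * q * r <= b r) && (b r + 6 * q < 16 * q * r + 16 * q).

(** Hence, of the two triples joined to a new vertex, only one meets a given red cycle. *)
Lemma region_next j : j <= q -> region j != region (next_class j).
Proof.
move=> jq; rewrite /region /next_class.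
have [_|jq'] := eqVneq j q; first by case: ifP => // /eqP E; lia.
by case: ifP => _; lia.
Qed.

Lemma spoke_offset j : j <= q -> (if j == q then 0 else 2 * j) + 2 <= 2 * q.
Proof. by move=> jq; case: eqP => E; lia. Qed.

Lemma spoke_region j t : j <= q -> t < 3 ->
  16 * q * region j <= spoke j t < 16 * q * region j + 16 * q.
Proof.
move=> jq t3; have := b_region (region_lt3 j); have := spoke_offset jq.
have tq : t * (2 * q) <= 2 * (2 * q) by rewrite leq_mul2r; lia.
rewrite /spoke; lia.
Qed.

Lemma spoke_region_succ j t : j <= q -> t < 3 ->
  16 * q * region j <= (spoke j t).+1 < 16 * q * region j + 16 * q.
Proof.
move=> jq t3; have := b_region (region_lt3 j); have := spoke_offset jq.
have tq : t * (2 * q) <= 2 * (2 * q) by rewrite leq_mul2r; lia.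
rewrite /spoke; lia.
Qed.

Lemma spokeE j t : spoke j t = b (region j) + 2 * ((if j == q then 0 else j) + t * q).
Proof. by rewrite /spoke; case: ifP => _; lia. Qed.

Lemma spoke_lt j t : j <= q -> t < 3 -> spoke j t < 48 * q.
Proof.
move=> jq t3; have /andP[_ lt] := spoke_region jq t3.
have : 16 * q * region j <= 16 * q * 2 by rewrite leq_mul2l -ltnS region_lt3 orbT.
lia.
Qed.

Lemma mem_triple j a : a \in triple j -> exists2 t, t < 3 & a = spoke j t.
Proof.
by rewrite !inE => /or3P[] /eqP->; [exists 0 | exists 1 | exists 2].
Qed.

Lemma triple_spoke j k t : j <= q -> k <= q -> t < 3 ->
  (spoke k t \in triple j) = (k == j).
Proof.
move=> jq kq t3; apply/idP/eqP => [|->]; last first.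
  by case: t t3 => [|[|[|t]]] // _; rewrite !inE eqxx ?orbT.
case/mem_triple=> t' t'3 E.
have := spoke_region kq t3; rewrite E => H.
have Er := region_uniq H (spoke_region jq t'3).
move: E (spoke_offset jq) (spoke_offset kq); rewrite /spoke Er.
move: Er; rewrite /region.
case: t t3 {H} => [|[|[|t]]] // _; case: t' t'3 => [|[|[|t']]] // _;
  case: eqP => kq'; case: eqP => jq' // Er; lia.
Qed.

(** On the same red cycle, the even distance excludes path edges and chords; otherwise the chord
    would leave its third, and the successor of a spoke still lies in the third of that spoke. *)
Lemma spoke_apart j k t t' : j <= q -> k <= q -> j != k -> t < 3 -> t' < 3 ->
  spoke j t < spoke k t' ->
  spoke k t' != (spoke j t).+1 /\ edge_in (chords q) (spoke j t) (spoke k t') = false.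
Proof.
move=> jq kq jk t3 t'3 lt.
have Rj := spoke_region jq t3; have Rk := spoke_region kq t'3.
have [Er|Er] := eqVneq (region j) (region k).
  have [d Ed] : exists d, spoke k t' = spoke j t + 2 * d.
    exists (((if k == q then 0 else k) + t' * q) - ((if j == q then 0 else j) + t * q)).
    by move: lt; rewrite !spokeE Er; lia.
  split; first by lia.
  by apply/negP => /(chord_dist q_gt0 lt) [r _ [_ _]]; lia.
split.
  apply: contraNneq Er => E; rewrite E in Rk.
  by rewrite (region_uniq (spoke_region_succ jq t3) Rk).
apply/negP => /(chord_dist q_gt0 lt) [r _ [H1 H2 _]].
have E1 : region j = r by apply: (region_uniq Rj); lia.
have E2 : region k = r by apply: (region_uniq Rk); lia.
by rewrite E1 E2 eqxx in Er.
Qed.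

End Spokes.

(** * New vertices joined to triples, and the blue alternating cycle *)

Section Wheel.

Variables (q : nat) (b v : nat -> nat) (h h' : position) (c : bool).

Hypothesis q_gt0 : 0 < q.
Hypothesis b_region : forall r, r < 3 ->
  (16 * q * r <= b r) && (b r + 6 * q < 16 * q * r + 16 * q).
Hypothesis vboard : board q h c v.
Hypothesis b_chord : forall r, r < 3 -> edge_in (chords q) (b r) (b r + (6 * q).-1).
Hypothesis b_red : forall r, r < 3 -> colored h c (v (b r)) (v (b r + (6 * q).-1)).
Hypothesis hh' : extends h (spokes q b v (vbound h)) h'.

Definition hub j := vbound h + j.

Lemma board_lt i : i < 48 * q -> v i < vbound h.
Proof.
case: vboard => _ vA _ lti.
have [lt|ge] := ltnP i.+1 (48 * q).
  have /adj_lt/andP[] // : background_adj h (v i) (v i.+1).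
  by rewrite vA ?eqxx // ltnS leqnn.
have /adj_lt/andP[] // : background_adj h (v i.-1) (v i).
by rewrite vA; lia.
Qed.

Lemma hub_neq j i : i < 48 * q -> hub j != v i.
Proof. by move/board_lt; rewrite /hub; lia. Qed.

Lemma next_class_le j : j <= q -> next_class q j <= q.
Proof. by rewrite /next_class; case: eqP; lia. Qed.

Lemma triples_lt j a : j <= q -> a \in triple q b j ++ triple q b (next_class q j) -> a < 48 * q.
Proof.
move=> jq; rewrite mem_cat => /orP[] /mem_triple[t t3 ->]; apply: spoke_lt => //.
exact: next_class_le.
Qed.

Lemma hub_adj j i : j <= q -> i < 48 * q ->
  background_adj h' (hub j) (v i) = (i \in triple q b j) || (i \in triple q b (next_class q j)).
Proof.
move=> jq iq; rewrite hh'.1 adj_ge ?leq_addr //= -mem_cat; apply/idP/idP => [|ij]; last first.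
  by apply/orP; left; apply/mem_spokes; exists j, i.
case/orP => /mem_spokes[k [a [kq ak E1 E2]]]; last first.
  by have := board_lt iq; rewrite E1; lia.
have aq := triples_lt kq ak.
have <- : k = j by rewrite /hub in E1; lia.
suff -> : i = a by [].
case: vboard => vI _ _; case: (ltngtP i a) => // lt.
  by have := vI i a; rewrite lt aq E2 eqxx => /(_ isT).
by have := vI a i; rewrite lt iq E2 eqxx => /(_ isT).
Qed.

Lemma hub_nonadj j k : j <= q -> k <= q -> background_adj h' (hub j) (hub k) = false.
Proof.
move=> jq kq; rewrite hh'.1 adj_ge ?leq_addr //=.
apply/negP => /orP[] /mem_spokes[l [a [lq al _ E]]];
  by have := board_lt (triples_lt lq al); rewrite -E /hub; lia.
Qed.

Lemma board_spokes : board q h' c v.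
Proof.
case: (vboard) => vI vA vC; split=> // [i j ij|i lt]; last exact/hh'.2/vC.
rewrite hh'.1 vA // -orbA; congr (_ || _).
rewrite [X in _ || X](_ : _ = false) ?orbF //.
apply/negP => /orP[] /mem_spokes[k [a [_ _ E _]]];
  have := @board_lt i; have := @board_lt j; lia.
Qed.

Hypothesis nocopy : ~ mono_induced_copy h' (cycle_graph (2 * q + 2)).

(** Cyclically consecutive spokes of a triple bound an arc with [2 * q + 1] vertices; two red edges
    to its ends would close a red cycle with the hub. *)
Lemma hub_red j k t : j <= q -> (k == j) || (k == next_class q j) -> t < 3 ->
  colored h' c (hub j) (v (spoke q b k t)) ->
  colored h' c (hub j) (v (spoke q b k (t.+1 %% 3))) -> False.
Proof.
move=> jq kj t3 c1 c2.
have kq : k <= q by case/orP: kj => /eqP-> //; apply: next_class_le.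
have r3 := region_lt3 q k; have off := spoke_offset q_gt0 kq.
have /andP[B1 B2] := b_region r3.
have B3 : 16 * q * region q k <= 16 * q * 2 by rewrite leq_mul2l -ltnS r3 orbT.
set o := (if k == q then 0 else 2 * k) in off.
have spE u : spoke q b k u = b (region q k) + o + u * (2 * q) by [].
pose s := o + t * (2 * q).
have s6 : s < 6 * q by rewrite /s; case: t t3 {c1 c2 s} => [|[|[|t]]] // _; lia.
have sE x : x <= 2 * q ->
    (s + x) %% (6 * q) = if s + x < 6 * q then s + x else s + x - 6 * q.
  move=> le; case: ltnP => lt; first by rewrite modn_small.
  by rewrite -[in LHS](subnK lt) modnDr modn_small; lia.
have lt48 x : x <= 2 * q -> b (region q k) + (s + x) %% (6 * q) < 48 * q.
  by move=> le; have := @ltn_pmod (s + x) (6 * q); lia.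
apply: nocopy; apply: (@board_red_pair q h' c v (b (region q k)) s (hub j)) => //.
- exact: board_spokes.
- lia.
- exact: b_chord.
- exact/hh'.2/b_red.
- by move=> x le; apply/hub_neq/lt48.
- move=> x le; have lt := lt48 x le; rewrite hub_adj //.
  set a := b _ + _ in lt *.
  have Ra : 16 * q * region q k <= a < 16 * q * region q k + 16 * q.
    by have := @ltn_pmod (s + x) (6 * q); rewrite /a; lia.
  (* The other triple of the hub lies in another third, so it adds no neighbor on the arc. *)
  have other l : l <= q -> region q l != region q k -> (a \in triple q b l) = false.
    move=> lq rl; apply/negP => /mem_triple[u u3 E]; case/eqP: rl.
    by rewrite E in Ra; apply: region_uniq (spoke_region q_gt0 b_region lq u3) Ra.
  have own : (a \in triple q b k) = (x == 0) || (x == 2 * q).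
    rewrite /a sE // !inE !spE /s.
    by case: t t3 {c1 c2 s s6 sE lt48 lt a Ra other} => [|[|[|t]]] // _; case: ltnP; lia.
  have rn := region_next q_gt0 jq.
  case/orP: kj => /eqP Ek.
    by rewrite -Ek own (other (next_class q k)) ?orbF // Ek 1?eq_sym // next_class_le.
  by rewrite -Ek own other // Ek.
- by rewrite addnA -spE.
- have <- : spoke q b k (t.+1 %% 3) = b (region q k) + (s + 2 * q) %% (6 * q) by
    rewrite sE // spE /s; case: t t3 {c1 c2 s s6 sE lt48} => [|[|[|t]]] // _;
    rewrite ?modnn; case: ltnP; lia.
  by [].
Qed.

Definition blue j k t := colored h' (~~ c) (hub j) (v (spoke q b k t)).

Lemma hub_blue j k t : j <= q -> (k == j) || (k == next_class q j) -> t < 3 ->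
  blue j k t || blue j k (t.+1 %% 3).
Proof.
move=> jq kj t3; apply/orP.
have kq : k <= q by case/orP: kj => /eqP-> //; apply: next_class_le.
have col u : u < 3 -> colored h' c (hub j) (v (spoke q b k u)) \/ blue j k u.
  move=> u3; apply: adj_colored; rewrite hub_adj ?spoke_lt //.
  by rewrite !triple_spoke // next_class_le.
case: (col t t3) => [c1|]; last by left.
case: (col (t.+1 %% 3)) => [|c2|]; [by rewrite ltn_pmod | | by right].
by case: (hub_red jq kj t3 c1 c2).
Qed.

(** Each hub has at most one red edge to the triple, so two hubs spoil at most two of its three
    spokes. *)
Lemma hubs_common_blue j j' k : j <= q -> j' <= q ->
  (k == j) || (k == next_class q j) -> (k == j') || (k == next_class q j') ->
  exists2 t, t < 3 & blue j k t && blue j' k t.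
Proof.
move=> jq j'q kj kj'.
have H t := @hub_blue j k t jq kj; have H' t := @hub_blue j' k t j'q kj'.
move: (H 0 isT) (H 1 isT) (H 2 isT) (H' 0 isT) (H' 1 isT) (H' 2 isT).
have [-> -> ->] : [/\ 1 %% 3 = 1, 2 %% 3 = 2 & 3 %% 3 = 0] by [].
case B0: (blue j k 0); case B0': (blue j' k 0); first by exists 0; rewrite ?B0.
all: case B1: (blue j k 1); case B1': (blue j' k 1) => //=; try by exists 1; rewrite ?B1.
all: by move=> *; exists 2; lia.
Qed.

Definition prev_class k := if k == 0 then q else k.-1.

Lemma wheel_cycle : False.
Proof.
(* [T k] selects in triple [k] a common blue neighbor of the two hubs joined to it. *)
have [T HT] : exists T, forall k, k <= q -> [/\ T k < 3, blue k k (T k) & blue (prev_class k) k (T k)].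
  have [k|T HT] := @choice _ _ (fun k t => k <= q -> [/\ t < 3, blue k k t & blue (prev_class k) k t]).
    have [kq|gt] := leqP k q; last by exists 0.
    have [|||t t3 /andP[b1 b2]] := @hubs_common_blue k (prev_class k) k kq.
    - by rewrite /prev_class; case: eqP; lia.
    - by rewrite eqxx.
    - rewrite /prev_class /next_class; case: (k =P 0) => [->|k0]; first by rewrite eqxx orbT.
      by case: ifP; lia.
    by exists t.
  by exists T.
pose spk k := spoke q b k (T k).
have spk_lt k : k <= q -> spk k < 48 * q by move=> kq; case: (HT k kq) => ? _ _; apply: spoke_lt.
have [vI vA _] := board_spokes.
have apart j k : j <= q -> k <= q -> j != k ->
    v (spk j) != v (spk k) /\ background_adj h' (v (spk j)) (v (spk k)) = false.
  wlog lt : j k / spk j < spk k.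
    move=> W jq kq jk; case: (ltngtP (spk j) (spk k)) => [lt|lt|E]; first exact: W.
      by rewrite eq_sym adjC; apply: W => //; rewrite eq_sym.
    have [t3 _ _] := HT j jq; have [t3' _ _] := HT k kq.
    have := triple_spoke q_gt0 b_region kq jq t3; rewrite -/(spk j) E.
    by rewrite triple_spoke // eqxx (negPf jk).
  move=> jq kq jk; have [t3 _ _] := HT j jq; have [t3' _ _] := HT k kq.
  have lt48 := spk_lt k kq.
  have [H1 H2] := spoke_apart q_gt0 b_region jq kq jk t3 t3' lt.
  by split; [apply: vI; rewrite lt | rewrite vA ?lt // (negPf H1) H2].
have hubE j k : j <= q -> k <= q ->
    background_adj h' (hub j) (v (spk k)) = (k == j) || (k == next_class q j).
  move=> jq kq; have [t3 _ _] := HT k kq.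
  by rewrite hub_adj ?spk_lt // !triple_spoke // next_class_le.
have blueE j k : j <= q -> k <= q -> (k == j) || (k == next_class q j) ->
    colored h' (~~ c) (hub j) (v (spk k)).
  move=> jq kq; have [t3 B1 B2] := HT k kq.
  case/orP=> /eqP E; first by rewrite -E.
  suff <- : prev_class k = j by [].
  by rewrite E /next_class /prev_class; case: (eqVneq j q) => [->|jq'].
(* Spokes and hubs alternate, hub [k] following spoke [k]; the length [2 * q + 2] is twice the
   number of classes. *)
pose f i := if odd i then hub i./2 else v (spk i./2).
apply: nocopy; apply: (@cycle_copy h' (~~ c) _ f) => i j ij.
have iq : i./2 <= q by lia.
have jq : j./2 <= q by lia.
rewrite /f /ring_adj; case Oi: (odd i); case Oj: (odd j).
- split; [by rewrite /hub; lia | by rewrite hub_nonadj //; lia | by lia].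
- have E : (j./2 == i./2) || (j./2 == next_class q i./2) =
      (j == i.+1) || (i == 0) && (j == (2 * q + 2).-1).
    by rewrite /next_class; case: (i./2 =P q); lia.
  by rewrite hubE // -E; split; [apply/hub_neq/spk_lt | | apply: blueE].
- have E : (i./2 == j./2) || (i./2 == next_class q j./2) =
      (j == i.+1) || (i == 0) && (j == (2 * q + 2).-1).
    by rewrite /next_class; case: (j./2 =P q); lia.
  rewrite adjC colored_sym hubE // -E; split=> //; last exact: blueE.
  by rewrite eq_sym; apply/hub_neq/spk_lt.
- have [|H1 H2] := apart i./2 j./2 iq jq; first by lia.
  by split=> //; [rewrite H2; lia | lia].
Qed.

End Wheel.

(** * The complete strategy and its number of rounds *)

Lemma board_of_ipath q h h' c s : ipath h c s -> size s = 48 * q ->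
  extends h [seq (nth 0 s e.1, nth 0 s e.2) | e <- chords q] h' ->
  all (fun e => (e.1 < 48 * q) && (e.2 < 48 * q)) (chords q) ->
  board q h' c (nth 0 s).
Proof.
move=> Hs sz [Ha Hc] /allP Hlt.
have vI i j : i < 48 * q -> j < 48 * q -> nth 0 s i = nth 0 s j -> i = j.
  move=> iq jq E; case: (ltngtP i j) => // lt.
    by have [|] := @ipath_nth h c s i j Hs; rewrite ?sz ?lt // E eqxx.
  by have [|] := @ipath_nth h c s j i Hs; rewrite ?sz ?lt // E eqxx.
have M x z : x < 48 * q -> z < 48 * q ->
   ((nth 0 s x, nth 0 s z) \in [seq (nth 0 s e.1, nth 0 s e.2) | e <- chords q]) =
   ((x, z) \in chords q).
  move=> xq zq; apply/mapP/idP => [[[x' z'] e [Ex Ez]]|e]; last by exists (x, z).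
  have /andP[/= x'q z'q] := Hlt _ e.
  by rewrite (vI _ _ xq x'q Ex) (vI _ _ zq z'q Ez).
split=> [i j ij|i j ij|i lt].
- by have [|] := @ipath_nth h c s i j Hs; rewrite ?sz.
- rewrite Ha /edge_in !M; [|lia..].
  by have [|_ ->] := @ipath_nth h c s i j Hs; rewrite ?sz.
- apply: Hc; have [|_ _] := @ipath_nth h c s i i.+1 Hs; last exact.
  by rewrite sz ltnSn.
Qed.

Lemma chords_lt q : 0 < q -> all (fun e => (e.1 < 48 * q) && (e.2 < 48 * q)) (chords q).
Proof.
move=> q0; apply/allP => -[a b] /mem_chords[r [i [j [r3 /andP[ij _] -> ->]]]] /=.
have : zigzag q i + 2 <= 16 * q by apply: zigzag_bound; lia.
have : zigzag q j + 2 <= 16 * q by apply: zigzag_bound; lia.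
have : 16 * q * r <= 16 * q * 2 by rewrite leq_mul2l; lia.
lia.
Qed.

Lemma chords_neq q e : 0 < q -> e \in chords q -> e.1 != e.2.
Proof.
case: e => a b q0 /mem_chords[r [i [j [r3 /andP[ij _] -> ->]]]] /=.
by have := zigzag_gap q0 ij; lia.
Qed.

Lemma force_cycle q : 0 < q ->
  force (mono_induced_copy^~ (cycle_graph (2 * q + 2)))
    (13 * (48 * q) + (3 * (2 * q + 2) + 6 * q.+1)) [::].
Proof.
move=> q0; apply: force_bind (force_ipath _) => h [c [s [Hs sz]]].
pose v := nth 0 s; set Q := mono_induced_copy^~ _.
have vne i j : i < 48 * q -> j < 48 * q -> i != j -> v i != v j.
  move=> iq jq; case: (ltngtP i j) => // lt _.
    by have [|] := @ipath_nth h c s i j Hs; rewrite ?sz ?lt.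
  by rewrite eq_sym; have [|] := @ipath_nth h c s j i Hs; rewrite ?sz ?lt.
rewrite -size_chords -(size_map (fun e => (v e.1, v e.2))).
apply: force_draw => [|h' hh'].
  apply/allP => _ /mapP[e ein ->] /=.
  by have /andP[? ?] := allP (chords_lt q0) e ein; apply: vne => //; apply: chords_neq q0 ein.
have Hb := board_of_ipath Hs sz hh' (chords_lt q0).
have [?|nc] := pselect (Q h'); first exact: force_now.
(* The spokes depend on which long chords Painter colored red, so they are fixed only now; 0 is a
   default for [r >= 3]. *)
have [r|b Hbr] := @choice _ _ (fun r x => r < 3 ->
   [/\ 16 * q * r <= x, x + 6 * q < 16 * q * r + 16 * q,
    edge_in (chords q) x (x + (6 * q).-1) & colored h' c (v x) (v (x + (6 * q).-1))]).
  have [r3|ge] := ltnP r 3; last by exists 0.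
  by case: (board_region q0 Hb r3) => // -[x Hx]; exists x.
have b_region r : r < 3 -> (16 * q * r <= b r) && (b r + 6 * q < 16 * q * r + 16 * q).
  by case/Hbr => -> ->.
rewrite -(size_spokes q b v (vbound h')) -[size _]addn0.
apply: force_draw => [|h2 h'h2].
  apply/allP => -[x z] /mem_spokes[j [a [jq aj -> ->]]] /=.
  by apply: (hub_neq q0 Hb j); apply: (triples_lt q0 b_region jq aj).
left; apply: contrapT => nocopy.
by apply: (wheel_cycle q0 b_region Hb _ _ h'h2 nocopy) => r /Hbr[].
Qed.

Theorem theorem3 (n : nat) (n_ge3 : 3 <= n) (n_even : ~~ odd n) :
  le_enat (induced_online_ramsey (cycle_graph n)) (Some (367 * n - 27)).
Proof.
have [q q0 ->] : exists2 q, 0 < q & n = 2 * q + 2.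
  by exists (n./2.-1); lia.
(* The strategy takes at most [636 * q + 12] rounds, which is [318 * n - 624]. *)
apply/builder_wins_le/force_builder_wins; apply: force_leq (force_cycle q0); lia.
Qed.
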